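(* Let $(X,T)$ be a transitive system and $n\ge 2$. Then $(X,T)$ is broken $\mathcal{F}_{inf}$-$n$-sensitive if and only if there exists an essential $n$-sensitive tuple $(x_1,x_2,\dots,x_n)$ in $(X,T)$ such that $$\limsup_{k\to\infty}\min_{1\le i<j\le n}d(T^kx_i,T^kx_j)>0.$$
   Context: A (topological dynamical) system $(X,T)$ is a compact metric space $X$ with metric $d$ and a continuous surjective map $T\colon X\to X$. $\mathbb{Z}_+=\{0,1,2,\dots\}$, $\mathbb{N}=\{1,2,\dots\}$. ''Opene'' means non-empty open. $(X,T)$ is transitive if for all opene $U,V\subset X$ the set $\{k\in\mathbb{Z}_+: U\cap T^{-k}V\ne\emptyset\}$ is infinite. $\mathcal{F}_{inf}$ is the family of all infinite subsets of $\mathbb{Z}_+$. For a family $\mathcal{F}$ of subsets of $\mathbb{Z}_+$, $(X,T)$ is broken $\mathcal{F}$-$n$-sensitive if there exist $\delta>0$ and $F\in\mathcal{F}$ such that for every opene $U\subset X$ and every $l\in\mathbb{N}$ there exist $x_1^l,\dots,x_n^l\in U$ and $m_l\in\mathbb{Z}_+$ with $\min_{1\le i<j\le n}d(T^kx_i^l,T^kx_j^l)>\delta$ for all $k\in m_l+(F\cap[1,l])$. A tuple $(x_1,\dots,x_n)\in X^n$ whose coordinates are not all equal is an $n$-sensitive tuple if for every opene $U\subset X$ and all open neighbourhoods $U_i$ of $x_i$ ($1\le i\le n$) there exist $y_1,\dots,y_n\in U$ and $m\in\mathbb{N}$ with $T^my_i\in U_i$ for all $i$. It is essential if moreover $x_i\ne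 x_j$ for all $i\ne j$. *)

(* Defs.v *)
From HB Require Import structures.
From mathcomp Require Import all_boot all_order all_algebra.
From mathcomp Require Import all_classical all_reals all_analysis.

Set Implicit Arguments.
Unset Strict Implicit.
Unset Printing Implicit Defensive.

Import Order.TTheory GRing.Theory Num.Theory.

Local Open Scope classical_set_scope.
Local Open Scope ring_scope.

Section DynamicalSystems.
Context {R : realType} {X : metricType R}.
Implicit Types (T : X -> X) (U V : set X) (n : nat).

(* The phase space of a system is non-empty by convention; a [metricType] may
   be empty, so this has to be said. *)
Record topological_dynamical_system T : Prop := TopologicalDynamicalSystem {
  tds_nonempty : [set: X] !=set0 ;
  tds_compact : compact [set: X] ;
  tds_continuous : continuous T ;
  tds_surjective : set_surj [set: X] [set: X] T }.

Definition opene U : Prop := open U /\ U !=set0.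

Definition transitive_map T : Prop := forall U V, opene U -> opene V ->
  infinite_set [set k : nat | U `&` (iter k T @^-1` V) !=set0].

(* Valued in [\bar R] so that the neutral element of the minimum is [+oo]; for
   [2 <= n] the value is the real number min_{i < j} d(x_i, x_j). *)
Definition min_pairwise_dist n (x : 'I_n -> X) : \bar R :=
  \big[Order.min/+oo%E]_(p : 'I_n * 'I_n | (p.1 < p.2)%N)
    (mdist (x p.1) (x p.2))%:E.

Definition broken_sensitive (FF : set (set nat)) n T : Prop :=
  exists delta : R, 0 < delta /\ exists F : set nat, FF F /\
    forall U (l : nat), opene U -> (1 <= l)%N ->
      exists (x : 'I_n -> X) (m : nat), (forall i, U (x i)) /\
        forall k : nat,
          [set (m + j)%N | j in F `&` [set j | (1 <= j <= l)%N]] k ->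
          (delta%:E < min_pairwise_dist (fun i => iter k T (x i)))%E.

Definition sensitive_tuple n T (x : 'I_n -> X) : Prop :=
  (exists i j, x i <> x j) /\
  forall U (N : 'I_n -> set X), opene U -> (forall i, open_nbhs (x i) (N i)) ->
    exists (y : 'I_n -> X) (m : nat), (forall i, U (y i)) /\ (0 < m)%N /\
      forall i, N i (iter m T (y i)).

Definition essential_sensitive_tuple n T (x : 'I_n -> X) : Prop :=
  sensitive_tuple T x /\ forall i j, i != j -> x i <> x j.

End DynamicalSystems.

Definition F_inf : set (set nat) := [set F | infinite_set F].

(* Main.v *)
Require Import Defs.
From mathcomp Require Import all_boot all_order all_algebra.
From mathcomp Require Import all_classical all_reals all_analysis.
From mathcomp Require Import lra zify.

(** From a sensitive tuple to broken sensitivity.  A positive limsup says that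
    the orbits of the [x i] are pairwise more than [c] apart at all times of an
    infinite set [F].  For a given [l], points close enough to the [x i] follow
    their orbits within [c / 4] up to time [l], so they are pairwise more than
    [c / 2] apart at the times of [F] in [1, l].  Sensitivity of the tuple puts
    such points in [iter m T @` U] for every opene [U]
    ([broken_of_sensitive_tuple]).

    From broken sensitivity to a sensitive tuple.  For an opene set [U] and
    bounds [K] and [l], consider the tuples [iter m T y_i] with all [y_i] in [U]
    and [m > K] which stay [c]-separated at all times at most [l] of a fixed
    infinite set [G] containing [0] ([late_images]).  The required tuple is a
    cluster point, in the compact space of tuples, of the filter that these
    sets generate: it is approximated from every [U], and its orbits remain
    separated along all of [G].  Two facts make this a proper filter.

    - Each set is non-empty ([late_images_nonempty]): starting from points of
      [U] whose orbits stay [c]-close up to time [K], separation can only occur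
      after time [K].

    - Any two of them contain a third one ([late_images_filter]): by
      transitivity a part [W] of [U] is mapped into [V] by some [iter k T], and
      the image of a point of [W] under [iter m T] is the image of a point of
      [V] under [iter (m - k) T], as soon as [m >= k].  The lower bound [K] on the time is
      there for this step.

    A single tuple thus serves all opene sets at once, and no point with a dense
    orbit has to be chosen. *)

Set Implicit Arguments.
Unset Strict Implicit.
Unset Printing Implicit Defensive.

Import Order.TTheory GRing.Theory Num.Theory.

Local Open Scope classical_set_scope.
Local Open Scope ring_scope.

(** * Infinite sets of times and the limsup *)

Lemma infinite_nat_unboundedP (F : set nat) :
  infinite_set F <-> forall N, exists2 k, (N <= k)%N & F k.
Proof.
split=> [infF N|unbF].
  apply: contrapT => noF; apply: infF.
  apply: (sub_finite_set _ (finite_II N)) => k Fk /=.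
  by rewrite ltnNge; apply/negP => Nk; apply: noF; exists k.
move=> /finite_seqP[A FA].
have [k lek Fk] := unbF (\max_(i <- A) i).+1.
have kA : k \in A by move: Fk; rewrite FA.
by have := @leq_bigmax_seq _ A xpredT id k kA isT; rewrite leqNgt lek.
Qed.

Lemma limn_esup_gt0P (R : realType) (u : nat -> \bar R) :
  (0 < limn_esup u)%E <->
  exists2 c : R, 0 < c & infinite_set [set k | (c%:E < u k)%E].
Proof.
rewrite /limn_esup limf_esupE; split=> [supu_gt0|[c c0 /infinite_nat_unboundedP Fu]].
  have [c c0 clt] : exists2 c : R, 0 < c & (c%:E < limn_esup u)%E.
    rewrite /limn_esup limf_esupE.
    case: (ereal_inf _) supu_gt0 => [r||] //=; last by exists 1 => //; rewrite ltry.
    by rewrite lte_fin => r0; exists (r / 2); rewrite ?lte_fin; lra.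
  exists c => //; apply/infinite_nat_unboundedP => N.
  have : (c%:E < ereal_sup [set u k | k in [set k | (N <= k)%N]])%E.
    apply: (lt_le_trans clt); apply: ereal_inf_lbound.
    by exists [set k | (N <= k)%N] => //; exact: nbhs_infty_ge.
  by case/ereal_sup_gt => _ [k /= Nk <-] ltu; exists k.
apply: (@lt_le_trans _ _ c%:E); first by rewrite lte_fin.
apply: le_ereal_inf_tmp => _ [V [N _ NV] <-].
have [k Nk uk] := Fu N.
by apply: (le_trans (ltW uk)); apply: ereal_sup_ubound; exists k => //; exact: NV.
Qed.

(** * Separation of tuples and closeness of orbits *)

Section Separation.
Context {R : realType} {X : metricType R}.
Implicit Types (T : X -> X) (n : nat).

Lemma min_pairwise_dist_gtP n (c : R) (x : 'I_n -> X) :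
  (c%:E < min_pairwise_dist x)%E <->
  forall i j, i != j -> c < mdist (x i) (x j).
Proof.
rewrite /min_pairwise_dist; split.
  move=> /bigmin_gtP[_ clt] i j.
  rewrite neq_ltn => /orP[ij|ji]; first by have := clt (i, j) ij; rewrite lte_fin.
  by have := clt (j, i) ji; rewrite lte_fin metric_sym.
move=> clt; apply/bigmin_gtP; split=> [|[i j] /= ij]; first by rewrite ltry.
by rewrite lte_fin; apply: clt; rewrite neq_ltn ij.
Qed.

(** Each pairwise distance changes by less than [2 * e]. *)
Lemma min_pairwise_dist_perturb n (c e : R) (x y : 'I_n -> X) :
  (forall i, mdist (x i) (y i) < e) ->
  ((c + e *+ 2)%:E < min_pairwise_dist x)%E -> (c%:E < min_pairwise_dist y)%E.
Proof.
move=> xy /min_pairwise_dist_gtP cx; apply/min_pairwise_dist_gtP => i j ij.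
have := cx i j ij; have := xy i; have := xy j.
have := metric_triangle (x i) (y i) (x j).
have := metric_triangle (y i) (y j) (x j).
rewrite (metric_sym (y j) (x j)); lra.
Qed.

Lemma min_pairwise_dist_injective n (c : R) (x : 'I_n -> X) :
  0 <= c -> (c%:E < min_pairwise_dist x)%E -> forall i j, i != j -> x i <> x j.
Proof.
move=> c0 /min_pairwise_dist_gtP cx i j ij xij.
by have := cx i j ij; rewrite xij mdistxx ltNge c0.
Qed.

Lemma continuous_iter T k : continuous T -> continuous (iter k T).
Proof.
move=> cT; elim: k => [|k IHk] x; first exact: cvg_id.
by apply: continuous_comp; [exact: IHk|exact: cT].
Qed.

(** Only finitely many iterates are involved, so this is a finite intersection
    of preimages of balls; it is what turns separation along an infinite set
    into an open condition, one bound [l] at a time. *)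
Lemma bowen_ball_nbhs T l (e : R) (x : X) : continuous T -> 0 < e ->
  \forall z \near x, forall k, (k <= l)%N -> mdist (iter k T x) (iter k T z) < e.
Proof.
move=> cT e0.
have : \forall z \near x, forall k : 'I_l.+1, mdist (iter k T x) (iter k T z) < e.
  apply: filter_forall => k.
  by apply: (metricType_numDomainType.cvgr_dist_lt _ e0); exact: continuous_iter.
by apply: filterS => z zk k kl; exact: (zk (Ordinal (kl : (k < l.+1)%N))).
Qed.

End Separation.

(** * The filter of late separated images *)

Section Sensitivity.
Context {R : realType} {X : metricType R} (T : X -> X) (n : nat).
Context (contT : continuous T).

(** Such a [W] cannot produce points [c] apart before time [K], which is how a
    separation is forced to happen late. *)
Lemma opene_coherent (U : set X) (K : nat) (c : R) : opene U -> 0 < c ->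
  exists2 W, opene W & W `<=` U /\ forall y z k, W y -> W z -> (k <= K)%N ->
    mdist (iter k T y) (iter k T z) < c.
Proof.
move=> [oU [u Uu]] c0; have c20 : 0 < c / 2 by lra.
have uB := nbhs_interior (bowen_ball_nbhs K u contT c20).
exists (U `&` [set z | forall k, (k <= K)%N ->
    mdist (iter k T u) (iter k T z) < c / 2]°).
  split; first exact: openI (open_interior _).
  by exists u; split=> //; exact: nbhs_singleton uB.
split=> [z []//|y z k [_ /interior_subset /= yB] [_ /interior_subset /= zB] kK].
have := yB k kK; have := zB k kK.
have := metric_triangle (iter k T y) (iter k T u) (iter k T z).
rewrite (metric_sym (iter k T y) (iter k T u)); lra.
Qed.

Lemma opene_pullback (U V : set X) : transitive_map T -> opene U -> opene V ->
  exists k, exists2 W, opene W & W `<=` U `&` (iter k T @^-1` V).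
Proof.
move=> trT oU oV; have [k _ Wn0] := (infinite_nat_unboundedP _).1 (trT U V oU oV) 0%N.
exists k, (U `&` (iter k T @^-1` V)) => //; split=> //.
apply: openI; first by case: oU.
by apply: open_comp; [move=> z _; exact: continuous_iter|case: oV].
Qed.

(** The parameters are packed in one triple because they index a filter base. *)
Definition late_images (c : R) (G : set nat) (p : set X * nat * nat) :
    set ('I_n -> X) :=
  let: (U, K, l) := p in
  [set z | exists (y : 'I_n -> X) (m : nat),
    [/\ forall i, U (y i), (K < m)%N, z = (fun i => iter m T (y i)) &
        forall g, G g -> (g <= l)%N ->
          (c%:E < min_pairwise_dist (fun i => iter g T (z i)))%E]].

(** Broken sensitivity does not separate the points at time [m] itself.  The set
    [F] is therefore translated to start at one of its positive elements [f]:
    the points are then separated at time [m + f], and since they come from a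
    set on which the first [K] iterates are coherent, [m + f] exceeds [K]. *)
Lemma late_images_nonempty : (2 <= n)%N -> broken_sensitive F_inf n T ->
  exists c : R, 0 < c /\ exists G : set nat,
    [/\ infinite_set G, G 0%N &
        forall U K l, opene U -> late_images c G (U, K, l) !=set0].
Proof.
move=> n2 [c [c0 [F [/infinite_nat_unboundedP infF sensF]]]].
exists c; split=> //.
(* [F] may contain [0], a time at which nothing is known. *)
have [f f1 Ff] := infF 1%N.
exists [set g | F (f + g)%N]; split; last 1 first.
- move=> U K l oU.
  have [W oW [WU Wc]] := opene_coherent K oU c0.
  have [y [m [Wy ysep]]] := sensF W (f + l)%N oW (ltn_addr _ f1).
  have sepG g : F (f + g)%N -> (g <= l)%N ->
      (c%:E < min_pairwise_dist (fun i => iter g T (iter (m + f) T (y i))))%E.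
    move=> Fg gl; have := ysep (m + (f + g))%N.
    have -> : (fun i => iter (m + (f + g)) T (y i)) =
              (fun i => iter g T (iter (m + f) T (y i))).
      by apply/funext => i; rewrite -iterD addnA addnC.
    apply; exists (f + g)%N => //; split => //=; lia.
  exists (fun i => iter (m + f) T (y i)), y, (m + f)%N; split=> // [i|].
    by apply: WU.
  have /min_pairwise_dist_gtP sep0 : (c%:E <
      min_pairwise_dist (fun i => iter 0 T (iter (m + f) T (y i))))%E.
    by apply: sepG => //=; rewrite addn0.
  rewrite ltnNge; apply/negP => mfK.
  (* With at least two points, separation contradicts coherence of [W]. *)
  have n1 : (1 < n)%N by [].
  have := sep0 (Ordinal (ltnW n1)) (Ordinal n1) isT.
  by rewrite ltNge (ltW (Wc _ _ _ (Wy _) (Wy _) mfK)).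
- apply/infinite_nat_unboundedP => N; have [k fNk Fk] := infF (f + N)%N.
  by exists (k - f)%N => /=; [lia|rewrite subnKC //; lia].
- by rewrite /= addn0.
Qed.

Lemma late_images_mono (c : R) (G : set nat) (U W : set X) K K' l l' :
  W `<=` U -> (K <= K')%N -> (l <= l')%N ->
  late_images c G (W, K', l') `<=` late_images c G (U, K, l).
Proof.
move=> WU KK' ll' z [y [m [Wy Km -> zG]]]; exists y, m; split=> //.
- by move=> i; apply: WU.
- exact: leq_ltn_trans Km.
- by move=> g Gg gl; apply: zG => //; exact: leq_trans ll'.
Qed.

(** The first [k] of the [m] iterations carry the points from [W] into [U]; more
    than [K] of them remain. *)
Lemma late_images_forward (c : R) (G : set nat) (U W : set X) k K l :
  W `<=` iter k T @^-1` U ->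
  late_images c G (W, (K + k)%N, l) `<=` late_images c G (U, K, l).
Proof.
move=> WU z [y [m [Wy Km -> zG]]]; exists (fun i => iter k T (y i)), (m - k)%N.
split=> //; [by move=> i; apply: WU|lia|].
by apply/funext => i; rewrite -iterD subnK //; lia.
Qed.

Lemma late_images_filter (c : R) (G : set nat) : transitive_map T ->
  [set: X] !=set0 ->
  (forall U K l, opene U -> late_images c G (U, K, l) !=set0) ->
  ProperFilter (filter_from [set p | opene p.1.1] (late_images c G)).
Proof.
move=> trT X0 n0; apply: filter_from_proper; last by case=> [[U K] l]; exact: n0.
apply: filter_from_filter.
  by exists (setT, 0%N, 0%N); split=> //=; exact: openT.
move=> [[U K] l] [[V K'] l'] /= oU oV.
have [k [W oW WUV]] := opene_pullback trT oU oV.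
exists (W, (maxn K K' + k)%N, maxn l l') => //= z zW; split.
  apply: late_images_mono zW; rewrite ?leq_maxl //.
    by move=> w /WUV[].
  by rewrite (leq_trans (leq_maxl K K')) // leq_addr.
apply: (@late_images_forward _ _ _ W k); first by move=> w /WUV[].
by apply: late_images_mono zW; rewrite ?leq_add2r ?leq_maxr.
Qed.

(** Tychonoff's theorem for a finite power.  Clustering is phrased with boxes of
    neighbourhoods because the bare function type ['I_n -> X] does not carry the
    product topology. *)
Lemma compact_tuples_cluster (F : set_system ('I_n -> X)) :
  compact [set: X] -> ProperFilter F ->
  exists x : 'I_n -> X, forall (A : set ('I_n -> X)) (N : 'I_n -> set X),
    F A -> (forall i, nbhs (x i) (N i)) -> exists2 z, A z & forall i, N i (z i).
Proof.
move=> cX PF.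
have cXn := @tychonoff 'I_n (fun=> X) (fun=> setT) (fun=> cX).
have [|x [_ xF]] := cXn F PF; first exact: filterS filterT.
exists x => A N FA Nx.
have box : nbhs (x : prod_topology (fun _ : 'I_n => X))
    [set z | forall i, N i (z i)].
  apply: (@filter_forall _ _ (fun i z => N i (z i)) _
    (nbhs_filter (x : prod_topology (fun _ : 'I_n => X)))) => i.
  exact: (@proj_continuous _ (fun _ : 'I_n => X) i x _ (Nx i)).
by have [z [Az Nz]] := xF _ _ FA box; exists z.
Qed.

(** * Broken sensitivity and essential sensitive tuples *)

(** At the cluster point the separation constant drops from [c] to [c / 2],
    because it is only approximated by [c]-separated tuples.  Separation at time
    [0], an element of [G], makes its coordinates distinct. *)
Lemma essential_tuple_of_broken : (2 <= n)%N -> [set: X] !=set0 ->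
  compact [set: X] -> transitive_map T -> broken_sensitive F_inf n T ->
  exists x : 'I_n -> X, essential_sensitive_tuple T x /\
    (0 < limn_esup (fun k => min_pairwise_dist (fun i => iter k T (x i))))%E.
Proof.
move=> n2 X0 cX trT /(late_images_nonempty n2)[c [c0 [G [infG G0 n0]]]].
have [x xF] := compact_tuples_cluster cX (late_images_filter trT X0 n0).
have late U K l : opene U ->
    filter_from [set p | opene p.1.1] (late_images c G) (late_images c G (U, K, l)).
  by exists (U, K, l).
have xsep g : G g ->
    ((c / 2)%:E < min_pairwise_dist (fun i => iter g T (x i)))%E.
  move=> Gg; have c40 : 0 < c / 4 by lra.
  have oT : opene [set: X] by split; [exact: openT|].
  have [z [y [m [_ _ _ zG]]] zx] := xF _ _ (late setT 0%N g oT)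
    (fun i => bowen_ball_nbhs g (x i) contT c40).
  apply: (@min_pairwise_dist_perturb _ _ _ _ (c / 4) (fun i => iter g T (z i))).
    by move=> i; rewrite metric_sym; exact: zx.
  by rewrite (_ : c / 2 + c / 4 *+ 2 = c) ?zG //; lra.
have xinj := min_pairwise_dist_injective (ltW (divr_gt0 c0 (ltr0Sn _ 1)))
  (xsep 0%N G0).
exists x; split; last first.
  apply/limn_esup_gt0P; exists (c / 2); first lra.
  by apply: sub_infinite_set infG => g; exact: xsep.
split=> //; split.
  by exists (Ordinal (ltnW n2)), (Ordinal n2); exact: xinj.
move=> U N oU Nx.
have [z [y [m [Uy m0 zE _]]] zN] := xF _ _ (late U 0%N 0%N oU)
  (fun i => open_nbhs_nbhs (Nx i)).
by exists y, m; do !split=> //; move=> i; have := zN i; rewrite zE.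
Qed.

Lemma broken_of_sensitive_tuple (x : 'I_n -> X) : sensitive_tuple T x ->
  (0 < limn_esup (fun k => min_pairwise_dist (fun i => iter k T (x i))))%E ->
  broken_sensitive F_inf n T.
Proof.
move=> [_ sensx] /limn_esup_gt0P[c c0 infF]; have c40 : 0 < c / 4 by lra.
exists (c / 2); split; first lra.
exists [set k | (c%:E < min_pairwise_dist (fun i => iter k T (x i)))%E].
split=> // U l oU _.
pose N i := [set z | forall k, (k <= l)%N ->
  mdist (iter k T (x i)) (iter k T z) < c / 4]°.
have Nx i : open_nbhs (x i) (N i).
  rewrite open_nbhsE; split; first exact: open_interior.
  exact/nbhs_interior/bowen_ball_nbhs.
have [y [m [Uy [_ yN]]]] := sensx U N oU Nx.
exists y, m; split=> // _ [k [/= Fk /andP[_ kl]] <-].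
have -> : (fun i => iter (m + k) T (y i)) = (fun i => iter k T (iter m T (y i))).
  by apply/funext => i; rewrite -iterD addnC.
apply: (@min_pairwise_dist_perturb _ _ _ _ (c / 4) (fun i => iter k T (x i))).
  by move=> i; exact: (interior_subset (yN i)).
by rewrite (_ : c / 2 + c / 4 *+ 2 = c) //; lra.
Qed.

End Sensitivity.

Theorem theorem2 (R : realType) (X : metricType R) (T : X -> X) (n : nat) :
  topological_dynamical_system T -> transitive_map T -> (2 <= n)%N ->
  (broken_sensitive F_inf n T <->
   exists x : 'I_n -> X, essential_sensitive_tuple T x /\
     (0 < limn_esup (fun k : nat =>
            min_pairwise_dist (fun i : 'I_n => iter k T (x i))))%E).
Proof.
move=> [X0 cX cT _] trT n2; split=> [|[x [[sensx _] supx]]].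
  exact: essential_tuple_of_broken.
exact: broken_of_sensitive_tuple sensx supx.
Qed.
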